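(* Let $\Delta$ be a finite simplicial complex with vertex set $V$, let $f:V\to\mathbb{R}$ be injective and discrete smooth on $\Delta$, and let $M$ be the greedy matching on the weighted Hasse diagram of $\Delta$. If $\sigma\in\Delta$ is critical, then every facet of $\sigma$ is matched above; that is, for every $\rho\prec\sigma$ there exists $\tau\in\Delta$ with $\rho\rightarrow\tau$.
   Context: A finite simplicial complex $\Delta$ with (nonempty, finite) vertex set $V$ is a family of subsets of $V$ (simplices) containing every singleton $\{v\}$, $v\in V$, and closed under taking subsets (so $\emptyset\in\Delta$, of dimension $-1$). $\dim\sigma=|\sigma|-1$. We write $\sigma\prec\tau$ (or $\tau\succ\sigma$), ''$\sigma$ is a facet of $\tau$'', if $\sigma\subset\tau$ and $\dim\sigma=\dim\tau-1$. A vertex $v$ is identified with $\{v\}$ in expressions such as $\sigma\setminus v$, $\sigma\cup v$. The Hasse diagram $H$ of $\Delta$ has the simplices of $\Delta$ as nodes and an arc $\{\sigma,\tau\}$ for each pair $\sigma\prec\tau$. The weight of the arc $\{\sigma,\tau\}$ is $f(v)$, where $\tau\setminus\sigma=\{v\}$. Two arcs sharing a node always have different weights. Greedy matching $M$: start with $M=\emptyset$; while arcs remain, add all remaining arcs of minimum weight to $M$ and delete the end nodes of these arcs (with all their incident arcs). We write $\sigma\rightarrow\tau$ if $\sigma\prec\tau$ and $\{\sigma,\tau\}\in M$. A simplex is critical if it belongs to no arc of $M$. For $\sigma\in\Delta$, $H(\sigma)=\{v\in V:\ v\in\sigma,\text{ or } v\notin\sigma\text{ and }\sigma\cup\{v\}\in\Delta\}$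 (the vertices whose $f$-values are the weights of the arcs incident to $\sigma$), and $h_f(\sigma)$ is the unique vertex of $H(\sigma)$ at which $f$ is minimal. A simplex $\sigma\in\Delta$ is discrete smooth if: whenever $h_f(\sigma)\in\sigma$, then for all $\tau\succ\sigma$ one has $h_f(\tau\setminus h_f(\sigma))=h_f(\sigma)$. The function $f$ is discrete smooth on $\Delta$ if every $\sigma\in\Delta$ is discrete smooth. *)

(* Defs.v *)
From mathcomp Require Import all_boot all_order all_algebra.
From mathcomp Require Import reals.

Set Implicit Arguments.
Unset Strict Implicit.
Unset Printing Implicit Defensive.

Import Order.TTheory GRing.Theory Num.Theory.
Local Open Scope ring_scope.

(* The vertex set is the whole finite type V. *)
Definition simplicial_complex (V : finType) (D : {set {set V}}) : Prop :=
  [/\ (0 < #|V|)%N,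
      forall v : V, [set v] \in D
    & forall s t : {set V}, t \in D -> s \subset t -> s \in D].

Section Complexes.
Variables (R : realType) (V : finType).
Implicit Types (D N : {set {set V}}) (s t : {set V}) (v w : V).

Definition dim s : int := #|s|%:Z - 1.

(* s ≺ t, that is, s is a facet of t. *)
Definition facet s t : bool := (s \subset t) && (dim s == dim t - 1).

Definition arc : predArgType := ({set V} * {set V})%type.
Implicit Types (e : arc) (A M : {set arc}).

(* An arc {s, t} with s ≺ t is represented by the ordered pair (s, t);
   [arcs N] are the arcs of the subgraph of the Hasse diagram induced on N. *)
Definition arcs N : {set arc} :=
  [set e : arc | [&& e.1 \in N, e.2 \in N & facet e.1 e.2]].

(* For an arc, e.2 :\: e.1 is a singleton [set v], so the sum is f v. *)
Definition weight (f : V -> R) e : R := \sum_(v in e.2 :\: e.1) f v.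

Definition min_arcs (f : V -> R) A : {set arc} :=
  [set e in A | [forall e' in A, weight f e <= weight f e']].

Definition ends A : {set {set V}} :=
  [set s | [exists e in A, (s == e.1) || (s == e.2)]].

(* A state consists of the remaining nodes and the matching built so far. *)
Definition greedy_step (f : V -> R) (st : {set {set V}} * {set arc}) :
    {set {set V}} * {set arc} :=
  let A := min_arcs f (arcs st.1) in (st.1 :\: ends A, st.2 :|: A).

Definition greedy_state (f : V -> R) D : {set {set V}} * {set arc} :=
  iter #|D| (greedy_step f) (D, set0).

(* #|D| rounds suffice, since every round in which an arc remains deletes a
   node and the other rounds change nothing; see [greedy_complete]. *)
Definition greedy_matching (f : V -> R) D : {set arc} := (greedy_state f D).2.

Definition matched_up M s t : bool := facet s t && ((s, t) \in M).

Definition critical M s : bool :=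
  [forall e in M, (s != e.1) && (s != e.2)].

Definition nbr D s : {set V} :=
  [set v | (v \in s) || ((v \notin s) && (v |: s \in D))].

(* The vertex h_f(s); the value None does not occur for a simplex of a
   simplicial complex (see [hmin_unique]). *)
Definition hmin (f : V -> R) D s : option V :=
  [pick v in nbr D s | [forall w in nbr D s, f v <= f w]].

Definition smooth_simplex (f : V -> R) D s : Prop :=
  forall v, hmin f D s = Some v -> v \in s ->
  forall t, t \in D -> facet s t -> hmin f D (t :\ v) = Some v.

Definition discrete_smooth (f : V -> R) D : Prop :=
  forall s, s \in D -> smooth_simplex f D s.

Lemma weight_arc (f : V -> R) s t v :
  t :\: s = [set v] -> weight f (s, t) = f v.
Proof. by rewrite /weight /= => ->; rewrite big_set1. Qed.

Lemma hmin_unique (f : V -> R) D s :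
    simplicial_complex D -> injective f ->
  exists2 v, hmin f D s = Some v
    & forall w, (w \in nbr D s) && [forall u in nbr D s, f w <= f u] = (w == v).
Proof.
case=> /card_gt0P[v0 _] D1 _ f_inj.
have [x xH] : exists x, x \in nbr D s.
  have [->|[x xs]] := set_0Vmem s; last by exists x; rewrite inE xs.
  by exists v0; rewrite inE in_set0 setU0 D1.
rewrite /hmin; case: pickP => [v /andP[vH /forall_inP vmin]|no_min].
  exists v => // w; apply/andP/eqP => [[wH /forall_inP wmin]|->].
    by apply/f_inj/le_anti; rewrite wmin ?vmin.
  by split=> //; apply/forall_inP.
have [v vH vmin] := arg_minP f xH.
by have /negP[] := negbT (no_min v); apply/andP; split=> //; apply/forall_inP.
Qed.

Lemma greedy_complete (f : V -> R) D : arcs (greedy_state f D).1 = set0.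
Proof.
suff H m : (arcs (iter m (greedy_step f) (D, set0)).1 == set0)
    || (#|(iter m (greedy_step f) (D, set0)).1| + m <= #|D|)%N.
  case/orP: (H #|D|) => [/eqP //|].
  rewrite -[leqRHS]add0n leq_add2r leqn0 cards_eq0 -/(greedy_state f D).
  by move/eqP->; apply/setP=> e; rewrite !inE.
elim: m => [|m]; first by rewrite addn0 leqnn orbT.
rewrite iterS; move: (iter m _ _) => [N M] /= IH.
have [A0|[e0 e0A]] := set_0Vmem (arcs N).
  suff -> : ends (min_arcs f (arcs N)) = set0 by rewrite setD0 A0 eqxx.
  apply/setP=> s; rewrite !inE; apply/negbTE/existsPn => e.
  by rewrite inE A0 in_set0.
have [e e_in emin] := arg_minP (weight f) e0A.
have eA : e \in arcs N := e_in.
have /set0Pn/negbTE arcsN : exists x, x \in arcs N by exists e0.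
rewrite arcsN /= in IH; apply/orP; right; apply: leq_trans IH.
rewrite addnS -addSn leq_add2r; apply: proper_card; apply/properP.
split; first exact: subsetDl.
exists e.1; first by move: eA; rewrite inE => /andP[].
rewrite in_setD negb_and negbK inE; apply/orP; left; apply/existsP; exists e.
by rewrite eqxx andbT inE eA; apply/forall_inP.
Qed.

End Complexes.

(* Main.v *)
(* If h_f(r) lies outside r, then the arc from r to r ∪ h_f(r) has minimum
   weight among all arcs meeting one of its ends, so it can only disappear from
   the greedy process by being selected: r is matched above.  Let now r be a
   facet of s and v = h_f(r).  If v is in r, smoothness of r gives
   h_f(s \ v) = v, so the arc from s \ v to s is selected and s is not
   critical. *)
Require Import Defs.
From mathcomp Require Import all_boot all_order all_algebra.
From mathcomp Require Import reals.
From mathcomp Require Import zify.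

Set Implicit Arguments.
Unset Strict Implicit.
Unset Printing Implicit Defensive.

Import Order.TTheory GRing.Theory Num.Theory.
Local Open Scope ring_scope.

Lemma facetP (V : finType) (s t : {set V}) :
  reflect (exists2 v, v \notin s & t = v |: s) (facet s t).
Proof.
apply: (iffP andP) => [[st /eqP dim_st]|[v vs ->]]; last first.
  split; first exact: subsetUr.
  apply/eqP; rewrite !/Defs.dim cardsU1 vs; lia.
have /cards1P[v tDs] : #|t :\: s| == 1%N.
  rewrite cardsDS //; apply/eqP; move: dim_st; rewrite !/Defs.dim; lia.
exists v; first by have /setDP[] : v \in t :\: s by rewrite tDs set11.
by rewrite -tDs setUC -{1}(setID t s) (setIidPr st).
Qed.

Section Greedy.
Variables (R : realType) (V : finType) (D : {set {set V}}) (f : V -> R).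
Hypothesis D_complex : simplicial_complex D.

Lemma weight_facet (s : {set V}) v : v \notin s -> weight f (s, v |: s) = f v.
Proof.
move=> vs; apply: weight_arc; apply/setP=> x; rewrite !inE.
by case: eqVneq => [->|_] /=; rewrite ?vs ?andbT //; case: (x \in s).
Qed.

(** Only a selected arc can delete a node, and a selected arc sharing an end with [e] forces [e] to
    be selected in the same round. So [e] persists until it is selected, and [greedy_complete] rules
    out that it persists forever. *)
Lemma greedy_locally_min_arc e :
    e \in arcs D ->
    (forall e', e' \in arcs D ->
      [|| e.1 == e'.1, e.1 == e'.2, e.2 == e'.1 | e.2 == e'.2] ->
      weight f e <= weight f e') ->
  e \in greedy_matching f D.
Proof.
move=> eD e_min.
(* The inclusion in [D] is carried along because [e_min] speaks only of arcs of [D]. *)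
suff inv m : let st := iter m (greedy_step f) (D, set0) in
    st.1 \subset D /\ ((e \in st.2) || (e \in arcs st.1)).
  have [_] := inv #|D|.
  by rewrite -/(greedy_state f D) greedy_complete in_set0 orbF.
elim: m => [|m]; first by rewrite /= eD orbT.
rewrite iterS; move: (iter m _ _) => [N M] /= [ND eNM].
split; first exact: subset_trans (subsetDl _ _) ND.
case/orP: eNM => [eM|eN]; first by rewrite in_setU eM.
have [eA|eA] := boolP (e \in min_arcs f (arcs N)).
  by rewrite in_setU eA orbT.
(* If [e'] met [e], then [e] would weigh at most [e'], hence at most every remaining arc [e''],
   against [eA]. *)
have untouched e' : e' \in min_arcs f (arcs N) ->
    ~~ [|| e.1 == e'.1, e.1 == e'.2, e.2 == e'.1 | e.2 == e'.2].
  rewrite inE => /andP[e'N /forall_inP e'_min].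
  apply: contra eA => /e_min le_ee'.
  rewrite inE eN; apply/forall_inP => e'' /e'_min; apply: le_trans.
  apply: le_ee'; move: e'N; rewrite !inE => /and3P[e1 e2 ->].
  by rewrite !(subsetP ND).
have [e1N e2N fe] : [/\ e.1 \in N, e.2 \in N & facet e.1 e.2].
  by apply/and3P; move: eN; rewrite inE.
apply/orP; right; rewrite inE !in_setD e1N e2N fe !andbT.
by apply/andP; split; rewrite inE; apply/exists_inPn => e' /untouched;
  apply: contra => /orP[] ->; rewrite ?orbT.
Qed.

Lemma hminP (s : {set V}) v : hmin f D s = Some v ->
  v \in nbr D s /\ forall w, w \in nbr D s -> f v <= f w.
Proof. by rewrite /hmin; case: pickP => // x /andP[? /forall_inP ?] [<-]. Qed.

Lemma nbr_coface (s t : {set V}) v :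
  t \in D -> s \subset t -> v \in t -> v \in nbr D s.
Proof.
case: D_complex => _ _ Dsub tD st vt; rewrite inE; case: (v \in s) => //=.
by apply: Dsub tD _; rewrite subUset sub1set vt.
Qed.

Lemma matched_hmin (s : {set V}) v :
    hmin f D s = Some v -> v \notin s ->
  v |: s \in D /\ matched_up (greedy_matching f D) s (v |: s).
Proof.
move=> /hminP[v_nbr v_min] vs.
have vsD : v |: s \in D by move: v_nbr; rewrite inE (negbTE vs).
have sD : s \in D by case: D_complex => _ _ /(_ s _ vsD); apply; apply: subsetUr.
have f_s : facet s (v |: s) by apply/facetP; exists v.
split=> //; rewrite /matched_up f_s; apply: greedy_locally_min_arc.
  by rewrite inE /= sD vsD.
case=> a b; rewrite inE /= => /and3P[_ bD /facetP[x xa b_eq]] touch.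
(* The competing arc from [a] to [b] has weight [f x] with [x] in [b]. Once [s] is contained in [b],
   [x] belongs to [nbr D s], where [v] is minimal. Each of the four ways of sharing an end gives
   this inclusion. *)
rewrite b_eq !weight_facet //; apply/v_min/(nbr_coface bD); last first.
  by rewrite b_eq setU11.
have ab : a \subset b by rewrite b_eq subsetUr.
case/or4P: touch => /eqP E.
- by rewrite E.
- by rewrite -E.
- by apply: subset_trans ab; rewrite -E subsetUr.
- by rewrite -E subsetUr.
Qed.

End Greedy.

Theorem theorem20 (R : realType) (V : finType) (D : {set {set V}}) (f : V -> R)
    (D_complex : simplicial_complex D)
    (f_inj : injective f)
    (f_smooth : discrete_smooth f D)
    (s : {set V}) (s_D : s \in D)
    (s_crit : critical (greedy_matching f D) s)
    (r : {set V}) (r_s : facet r s) :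
  exists2 t : {set V}, t \in D & matched_up (greedy_matching f D) r t.
Proof.
have rs : r \subset s by case/andP: r_s.
have rD : r \in D by case: D_complex => _ _; apply; eassumption.
have [v hr _] := hmin_unique r D_complex f_inj.
have [vr|vr] := boolP (v \in r); last first.
  by have [] := matched_hmin D_complex hr vr; exists (v |: r).
have hs := f_smooth r rD v hr vr s s_D r_s.
have [|_ /andP[_]] := matched_hmin D_complex hs; first by rewrite setD11.
(* As [v] lies in [r], hence in [s], putting [v] back into [s :\ v] restores [s], the upper end of
   the selected arc. *)
rewrite setD1K ?(subsetP rs) // => sM.
by have /forall_inP/(_ _ sM) := s_crit; rewrite eqxx andbF.
Qed.
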